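(* Let $\mathbf{A}$ be a semilattice and $\langle X,\mathcal{K}\rangle$ an $S$-space, and let $R\subseteq X\times X(\mathbf{A})$ be a one-to-one meet-relation. Then $\langle\mathcal{F}_R,\mathcal{M}\rangle$ is an $S$-space, where $\mathcal{F}_R=\{R(x)\colon x\in X\}$, $\mathcal{M}=\{H_a\colon a\in A\}$ and $H_a=\{R(x)\colon R(x)\cap\beta(a)^c\neq\emptyset\}$.
   Context: A semilattice is a meet-semilattice with top. A proper filter is irreducible if not the intersection of two filters both different from it; $X(\mathbf{A})$ is the set of irreducible filters, $\beta(a)=\{P\in X(\mathbf{A})\colon a\in P\}$, and $X(\mathbf{A})$ carries the subbase $\mathcal{K}_\mathbf{A}=\{\beta(a)^c\colon a\in A\}$, so $S(X(\mathbf{A}))=\{\beta(a)\colon a\in A\}$. An $S$-space is a pair $\langle X,\mathcal{K}\rangle$, $\mathcal{K}$ a subbase of a topology, such that with $S(X)=\{U^c\colon U\in\mathcal{K}\}$ and $C_\mathcal{K}(X)$ the set of intersections of subfamilies of $S(X)$: (S1) $T_0$ and $X=\bigcup\mathcal{K}$; (S2) $\mathcal{K}$ consists of compact opens, is closed under finite unions, $\emptyset\in\mathcal{K}$; (S3) for $U,V\in\mathcal{K}$, $x\in U\cap V$, there exist $W,D\in\mathcal{K}$ with $x\notin W$, $x\in D$, $D\subseteq(U\cap V)\cup W$; (S4) if $Y\in C_\mathcal{K}(X)$ and $\mathcal{J}\subseteq S(X)$ is a $Y$-family (for $A,B\in\mathcal{J}$ there exist $H\in S(X)$, $C\in\mathcal{J}$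 with $Y\subseteq H$, $A\cap H\subseteq C$, $B\cap H\subseteq C$) with $Y\cap A^c\ne\emptyset$ for all $A\in\mathcal{J}$, then $Y\cap\bigcap\{A^c\colon A\in\mathcal{J}\}\ne\emptyset$. (The dual space $\langle X(\mathbf{A}),\mathcal{K}_\mathbf{A}\rangle$ is an $S$-space.) A meet-relation between $S$-spaces $X_1,X_2$ is $T\subseteq X_1\times X_2$ with $\Box_T(U)=\{x\colon T(x)\subseteq U\}\in S(X_1)$ for all $U\in S(X_2)$ and $T(x)=\bigcap\{U\in S(X_2)\colon T(x)\subseteq U\}$ for all $x$. It is one-to-one if for each $x\in X_1$ and $U\in S(X_1)$ with $x\notin U$, there is $V\in S(X_2)$ with $U\subseteq\Box_T(V)$ and $x\notin\Box_T(V)$.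
   Formalization: In (S4), Y-families are required to be nonempty: with the empty family allowed, Y = ∅ (which lies in C_K(X) because X = ⋃K) would violate (S4), so no S-space would exist. *)

(* Defs.v *)
From HB Require Import structures.
From mathcomp Require Import all_boot all_order.
From mathcomp Require Import boolp classical_sets topology.

Set Implicit Arguments.
Unset Strict Implicit.
Unset Printing Implicit Defensive.

Import Order.TTheory.

Local Open Scope classical_set_scope.

(** Filters of a meet-semilattice with top *)

Record slat_filter (d : Order.disp_t) (A : tMeetSemilatticeType d)
    (F : set A) : Prop := SlatFilter {
  slat_filter_top : F (\top)%O ;
  slat_filter_up : forall a b : A, F a -> (a <= b)%O -> F b ;
  slat_filter_meet : forall a b : A, F a -> F b -> F (a `&` b)%O }.

Definition irreducible_filter (d : Order.disp_t) (A : tMeetSemilatticeType d) :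
    set (set A) :=
  [set P | [/\ slat_filter P, P <> setT &
    forall F G : set A, slat_filter F -> slat_filter G ->
      P = F `&` G -> P = F \/ P = G]].
Arguments irreducible_filter {d} A.

(** The underlying type of X(A) *)
Definition irr (d : Order.disp_t) (A : tMeetSemilatticeType d) : Type :=
  set_type (irreducible_filter A).

Definition beta (d : Order.disp_t) (A : tMeetSemilatticeType d) (a : A) :
    set (irr A) :=
  [set P : irr A | sval P a].

Definition dual_subbase (d : Order.disp_t) (A : tMeetSemilatticeType d) :
    set (set (irr A)) :=
  range (fun a : A => ~` beta a).
Arguments dual_subbase {d} A.

(** The type [X] equipped with the topology that has [K] as a subbase. The
    equality and choice structures are the classical ones. *)
Definition subbase_space (X : Type) (K : set (set X)) : Type := X.

Section SubbaseTopology.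
Variables (X : Type) (K : set (set X)).
HB.instance Definition _ := gen_eqMixin (subbase_space K).
HB.instance Definition _ := gen_choiceMixin (subbase_space K).
HB.instance Definition _ :=
  @isSubBaseTopological.Build (subbase_space K) (set X) K id.
End SubbaseTopology.

(** The set S(X) *)
Definition cosubbase (X : Type) (K : set (set X)) : set (set X) :=
  [set ~` U | U in K].

(** The set C_K(X); the empty subfamily has intersection [setT] *)
Definition subbasic_closed (X : Type) (K : set (set X)) : set (set X) :=
  [set Y | exists2 F : set (set X),
    F `<=` cosubbase K & Y = \bigcap_(U in F) U].

(** Families are nonempty: the empty one would make (S4) fail for [Y = set0],
    which belongs to C_K(X) as soon as [K] covers [X]. *)
Definition Yfamily (X : Type) (K : set (set X)) (Y : set X)
    (J : set (set X)) : Prop :=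
  [/\ J !=set0, J `<=` cosubbase K &
    forall A B : set X, J A -> J B ->
      exists H C : set X, [/\ cosubbase K H, J C, Y `<=` H,
        A `&` H `<=` C & B `&` H `<=` C]].

Record Sspace (X : Type) (K : set (set X)) : Prop := MkSspace {
  Sspace_T0 : kolmogorov_space (subbase_space K) ;
  Sspace_cover : \bigcup_(U in K) U = setT ;
  Sspace_open_compact : forall U : set (subbase_space K), K U ->
    open U /\ compact U ;
  Sspace_setU : forall U V : set X, K U -> K V -> K (U `|` V) ;
  Sspace_set0 : K set0 ;
  Sspace_S3 : forall (U V : set X) (x : X), K U -> K V -> (U `&` V) x ->
    exists W D : set X, [/\ K W, K D, ~ W x, D x &
      D `<=` (U `&` V) `|` W] ;
  Sspace_S4 : forall (Y : set X) (J : set (set X)),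
    subbasic_closed K Y -> Yfamily K Y J ->
    (forall A, J A -> Y `&` ~` A !=set0) ->
    Y `&` \bigcap_(A in J) ~` A !=set0 }.

(** [xsection T x] is T(x) *)
Definition box (X1 X2 : Type) (T : set (X1 * X2)) (U : set X2) : set X1 :=
  [set x | xsection T x `<=` U].

Definition meet_relation (X1 X2 : Type) (K1 : set (set X1)) (K2 : set (set X2))
    (T : set (X1 * X2)) : Prop :=
  (forall U : set X2, cosubbase K2 U -> cosubbase K1 (box T U)) /\
  (forall x : X1, xsection T x =
    \bigcap_(U in [set U | cosubbase K2 U /\ xsection T x `<=` U]) U).

Definition one_to_one (X1 X2 : Type) (K1 : set (set X1)) (K2 : set (set X2))
    (T : set (X1 * X2)) : Prop :=
  forall (x : X1) (U : set X1), cosubbase K1 U -> ~ U x ->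
    exists V : set X2, [/\ cosubbase K2 V, U `<=` box T V & ~ box T V x].

(** The underlying type of the set of all R(x) *)
Definition FR (X Y : Type) (R : set (X * Y)) : Type :=
  set_type (range (xsection R)).

Definition HR (d : Order.disp_t) (A : tMeetSemilatticeType d) (X : Type)
    (R : set (X * irr A)) (a : A) : set (FR R) :=
  [set Y : FR R | sval Y `&` ~` beta a !=set0].

Arguments HR {d A X} R a.

Definition MR (d : Order.disp_t) (A : tMeetSemilatticeType d) (X : Type)
    (R : set (X * irr A)) : set (set (FR R)) :=
  range (HR R).
Arguments MR {d A X} R.

(* Main.v *)
Require Import Defs.
From mathcomp Require Import all_boot all_order.
From mathcomp Require Import finmap boolp classical_sets topology.

(** The map [x |-> R(x)] from [X] onto the set of all [R(x)] pulls [M] back to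
    exactly [K], so every axiom of an S-space transfers along it. Indeed the
    preimage of [H_a] is the complement of [box R (beta a)], which lies in [K].
    Conversely, one-to-oneness says that every [U] in [K] is a union of such
    preimages; as [U] is compact and [H_a `|` H_b = H_(a `&` b)], [U] is itself
    a preimage. *)

Set Implicit Arguments.
Unset Strict Implicit.
Unset Printing Implicit Defensive.

Import Order.TTheory.

Local Open Scope classical_set_scope.

(** If [U] were not in [B], the sets [U]\[V] for [V] in [B] inside [U] would generate a proper
    filter: unions in [B] make them directed, and an empty one would force [U = V]. Compactness
    gives a cluster point in [U], but some open [V] of [B] inside [U] contains it and misses
    [U]\[V]. *)
Lemma compact_directed_cover (T : topologicalType) (U : set T)
    (B : set (set T)) :
  compact U -> B set0 -> (forall V W, B V -> B W -> B (V `|` W)) ->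
  (forall V, B V -> open V) ->
  (forall x, U x -> exists V, [/\ B V, V x & V `<=` U]) -> B U.
Proof.
move=> cU B0 BU Bo Ucov; apply: contrapT => nBU.
pose D := [set V | B V /\ V `<=` U].
pose F := filter_from D (fun V => U `\` V).
have FF : ProperFilter F.
  apply: filter_from_proper.
    apply: filter_from_filter; first by exists set0; split.
    move=> V W [BV VU] [BW WU]; exists (V `|` W).
      by split; [exact: BU | rewrite subUset].
    by move=> x [Ux nVW]; split; split=> // ?; apply: nVW; [left | right].
  move=> V [BV VU]; apply: contrapT => UV0; apply: nBU.
  suff -> : U = V by [].
  apply/seteqP; split=> // x Ux; apply: contrapT => nVx.
  by apply: UV0; exists x.
have FU : F U by exists set0; [split | move=> x []].
have [x [Ux clx]] := cU F FF FU.
have [V [BV Vx VU]] := Ucov x Ux.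
have FUV : F (U `\` V) by exists V.
have nV : nbhs x V by apply: open_nbhs_nbhs; split => //; exact: Bo.
by have [y [[_ nVy] Vy]] := clx _ _ FUV nV.
Qed.

Section SubbaseSpace.
Variables (X : Type) (K : set (set X)).

Lemma subbase_open (U : set X) : K U -> open (U : set (subbase_space K)).
Proof.
move=> KU; exists [set U]; last by rewrite bigcup_set1.
by move=> _ ->; exact: (@finI_from1 _ _ K id).
Qed.

Lemma subbase_nbhs (x : X) (O : set X) :
  nbhs (x : subbase_space K) O ->
  exists2 E : {fset set X}, {subset E <= K} &
    (forall U, U \in E -> U x) /\ \bigcap_(U in [set` E]) U `<=` O.
Proof.
rewrite nbhsE => -[_ [[D DK <-] [V DV Vx]] DO].
have [E EK EV] := DK _ DV; exists E => //.
split=> [U UE|y Ey]; first by move: Vx; rewrite -EV; exact.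
by apply: DO; exists V => //; rewrite -EV.
Qed.

(** If a neighbourhood of [x] omits [y], so does one of the finitely many members of [K] around [x]
    whose intersection it contains. This puts T0 in terms of [K] alone, ready to be transported. *)
Lemma kolmogorov_subbaseP :
  kolmogorov_space (subbase_space K) <->
  (forall x y, x <> y ->
    exists2 U, K U & (U x /\ ~ U y) \/ (U y /\ ~ U x)).
Proof.
have sep (x y : X) O : nbhs (x : subbase_space K) O -> ~ O y ->
    exists2 U, K U & U x /\ ~ U y.
  move=> /subbase_nbhs[E EK [Ex EO]] nOy; apply: contrapT => nU.
  apply: nOy; apply: EO => U UE; apply: contrapT => nUy; apply: nU.
  by exists U; [apply/set_mem/EK | split=> //; exact: Ex].
split=> [T0 x y xy|T0 x y /eqP/T0[U KU xUy]].
  have [|O] := T0 x y; first exact/eqP.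
  rewrite !inE => -[[xO /= nOy]|[yO /= nOx]].
  - by have [U KU UP] := sep _ _ _ xO nOy; exists U => //; left.
  - by have [U KU UP] := sep _ _ _ yO nOx; exists U => //; right.
exists U; rewrite !inE.
case: xUy => -[? ?]; [left | right]; split => //;
  by apply: open_nbhs_nbhs; split=> //; exact: subbase_open.
Qed.

End SubbaseSpace.

Section Transport.
Variables (X Y : Type) (f : X -> Y) (K : set (set X)) (M : set (set Y)).
Hypotheses (fsurj : range f = setT) (KM : K = [set f @^-1` V | V in M]).

Let fK (V : set Y) : f @` (f @^-1` V) = V.
Proof. exact: image_preimage. Qed.

Let lift y : exists x, f x = y.
Proof. by have : setT y by []; rewrite -fsurj => -[x _ <-]; exists x. Qed.

(** Surjectivity of [f] makes taking preimages injective, so a preimage in [K] can only come from a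
    member of [M]. *)
Let KMP (V : set Y) : K (f @^-1` V) <-> M V.
Proof.
rewrite KM; split=> [[W MW fWV]|]; last by exists V.
by rewrite -(fK V) -fWV fK.
Qed.

Let cosubbaseP (V : set Y) : cosubbase K (f @^-1` V) <-> cosubbase M V.
Proof.
split=> [[U KU UV]|[W MW <-]].
  exists (~` V); last by rewrite setCK.
  by apply/KMP; rewrite -preimage_setC -UV setCK.
by exists (f @^-1` W); [exact/KMP | rewrite preimage_setC].
Qed.

Let continuous_transport :
  continuous (f : subbase_space K -> subbase_space M).
Proof.
move=> x O xO; have [E EM [Ex EO]] := @subbase_nbhs _ M (f x) O xO.
have : nbhs (x : subbase_space K) (\bigcap_(U in [set` E]) (f @^-1` U)).
  apply: filter_bigI => U UE; apply: open_nbhs_nbhs; split; last exact: Ex.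
  by apply: subbase_open; apply/KMP/set_mem/EM.
by apply: filterS => y Ey; exact: EO.
Qed.

Lemma Sspace_transport : Sspace K -> Sspace M.
Proof.
case=> T0 cov oc KU K0 S3 S4; split.
- apply/kolmogorov_subbaseP => y1 y2.
  have [x1 <-] := lift y1; have [x2 <-] := lift y2 => x12.
  have /(iffLR (kolmogorov_subbaseP K) T0)[U] : x1 <> x2.
    by move=> e; rewrite e in x12.
  by rewrite KM => -[V MV <-]; exists V.
- apply/seteqP; split=> // y _; have [x <-] := lift y.
  have [U KUx Ux] : (\bigcup_(U in K) U) x by rewrite cov.
  by move: KUx Ux; rewrite KM => -[V MV <-] Vx; exists V.
- move=> V MV; split; first exact: subbase_open.
  (* [V] is the continuous image of its preimage, which is compact as a member of [K]. *)
  rewrite -[V]fK.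
  apply: (@continuous_compact (subbase_space K) (subbase_space M) f).
    exact: continuous_subspaceT.
  by apply: (oc _ _).2; exact/KMP.
- by move=> U V /KMP MU /KMP MV; apply/KMP; exact: (KU _ _ MU MV).
- exact/KMP.
- move=> U V y; have [x <-] := lift y => /KMP MU /KMP MV UVx.
  (* The sets given by (S3) in [K] are themselves preimages of members of [M], which are the
     witnesses below. *)
  have [W [D [+ + nWx Dx DUV]]] := S3 _ _ x MU MV UVx.
  rewrite KM => -[W' MW eW] [D' MD eD]; exists W', D'.
  rewrite -eW in nWx DUV; rewrite -eD in Dx DUV; split=> // z.
  by have [t <-] := lift z; exact: DUV.
- move=> Z J [G GM eZ] [[A0 JA0] JM Jdir] JZ.
  (* Preimages commute with intersections and preserve inclusions, so the hypotheses of (S4) pull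
     back to [K]; the point found there is pushed forward by [f]. *)
  have [|||x [Zx Jx]] := S4 (f @^-1` Z) [set f @^-1` A | A in J].
  + exists [set f @^-1` U | U in G].
      by move=> _ [U GU <-]; apply/cosubbaseP; exact: GM.
    by rewrite bigcap_image eZ preimage_bigcap.
  + split; first by exists (f @^-1` A0), A0.
      by move=> _ [U JU <-]; apply/cosubbaseP; exact: JM.
    move=> _ _ [A JA <-] [B JB <-].
    have [H [C [MH JC ZH AC BC]]] := Jdir _ _ JA JB.
    exists (f @^-1` H), (f @^-1` C); split.
    * exact/cosubbaseP.
    * by exists C.
    * by move=> x; exact: ZH.
    * by move=> x; exact: AC.
    * by move=> x; exact: BC.
  + move=> _ [A JA <-]; have [y] := JZ _ JA.
    by have [x <-] := lift y; exists x.
  + exists (f x); split=> // B JB.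
    by apply: (Jx (f @^-1` B)); exists B.
Qed.

End Transport.

Section ImageSpace.
Variables (d : Order.disp_t) (A : tMeetSemilatticeType d) (X : Type).
Variable R : set (X * irr A).

Definition to_FR (x : X) : FR R :=
  exist _ (xsection R x) (mem_set (imageT (xsection R) x)).

Lemma range_to_FR : range to_FR = setT.
Proof.
apply/seteqP; split=> // -[Y RY] _; have [x _ xY] := set_mem RY.
by exists x => //; exact: val_inj.
Qed.

Lemma preimage_HR (a : A) : to_FR @^-1` HR R a = ~` box R (beta a).
Proof.
apply/seteqP; split=> x; first by move=> [P [RP nP]] /(_ _ RP).
by move=> /existsNP[P /not_implyP[RP nP]]; exists P.
Qed.

(** A filter contains a meet exactly when it contains both elements, so the complement of
    [beta (a]&[b)] is the union of those of [beta a] and [beta b]. *)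
Lemma HR_meet (a b : A) : HR R (a `&` b)%O = HR R a `|` HR R b.
Proof.
have betaI (P : irr A) : beta (a `&` b)%O P <-> beta a P /\ beta b P.
  have [[_ up meet] _ _] := set_mem (svalP P).
  split=> [Pab|[]]; last exact: meet.
  by split; apply: up Pab _; rewrite ?leIl ?leIr.
apply/seteqP; split=> [Y [P [YP nP]]|Y [] [P [YP nP]]].
- have [Pa|nPa] := pselect (beta a P); last by left; exists P.
  by right; exists P; split=> // Pb; apply: nP; apply/betaI.
- by exists P; split=> // /betaI[].
- by exists P; split=> // /betaI[].
Qed.

Lemma HR_top : HR R \top%O = set0.
Proof.
apply/seteqP; split=> // Y [P [_]]; apply.
by have [[]] := set_mem (svalP P).
Qed.

Lemma subbase_preimage_MR (K : set (set X)) :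
  Sspace K -> meet_relation K (dual_subbase A) R ->
  one_to_one K (dual_subbase A) R -> K = [set to_FR @^-1` V | V in MR R].
Proof.
move=> SK [boxK _] inj.
have MRK V : MR R V -> K (to_FR @^-1` V).
  move=> [a _ <-]; rewrite preimage_HR.
  have [|U KU <-] := boxK (beta a); last by rewrite setCK.
  by exists (~` beta a); [exists a | rewrite setCK].
apply/seteqP; split=> [U KU|_ [V MV <-]]; last exact: MRK.
have [_ cU] := Sspace_open_compact SK KU.
(* The preimages of members of [MR R] include the empty set by [HR_top] and are closed under unions
   by [HR_meet]. *)
apply: (compact_directed_cover cU).
- by exists set0 => //; exists \top%O => //; exact: HR_top.
- move=> _ _ [_ [a _ <-] <-] [_ [b _ <-] <-].
  by exists (HR R (a `&` b)%O); [exists (a `&` b)%O | rewrite HR_meet].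
- by move=> _ [V MV <-]; apply: subbase_open; exact: MRK.
(* One-to-oneness for [x] and the complement of [U] gives a box of [beta a] that contains this
   complement and omits [x]; the complement of the box is then a preimage around [x] inside [U]. *)
move=> x Ux; have [||_ [[_ [a _ <-] <-] UV nVx]] := inj x (~` U).
- by exists U.
- exact.
rewrite setCK in UV nVx.
exists (to_FR @^-1` HR R a); rewrite preimage_HR; split=> //.
  by exists (HR R a); [exists a | exact: preimage_HR].
by move=> y; apply: contra_notP => /UV.
Qed.

End ImageSpace.

Theorem theorem9 (d : Order.disp_t) (A : tMeetSemilatticeType d) (X : Type)
    (K : set (set X)) (R : set (X * irr A)) :
  Sspace K ->
  meet_relation K (dual_subbase A) R ->
  one_to_one K (dual_subbase A) R ->
  Sspace (MR R).
Proof.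
move=> SK mR oR.
exact: (Sspace_transport (range_to_FR R) (subbase_preimage_MR SK mR oR)).
Qed.
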